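(* Suppose that $$f(\mathbf x,\mathbf y)=a_{11}x_1^2y_1^2+x_1^2y_2^2+x_2^2y_1^2+a_{22}x_2^2y_2^2+2c_xx_1^2y_1y_2+2c_yx_1x_2y_1^2,$$ where $c_x^2<a_{11}<c_x^2+c_y^2$, $a_{22}>0$, and $c_x\ge c_y>0$. Then the following three statements are equivalent: (a) $f(\mathbf x,\mathbf y)$ is PSD. (b) $f(\mathbf x,\mathbf y)$ is SOS. (c) It holds that $$a_{22}\ge\begin{cases}\dfrac{8c_y}{\bigl(3c_y-\sqrt{9c_y^2-4a_{11}}\bigr)^3}-\dfrac{4}{\bigl(3c_y-\sqrt{9c_y^2-4a_{11}}\bigr)^2}, & \text{if } c_x=c_y \text{ and } \tfrac54c_y^2\le a_{11}\le 2c_y^2,\\[2ex] \dfrac{1}{a_{11}-c_x^2}-\dfrac{4}{\bigl(3c_y-\sqrt{9c_y^2-4a_{11}}\bigr)^2}, & \text{if } c_x=c_y\text{ and } c_y^2\le a_{11}\le\tfrac54c_y^2,\\[2ex] \dfrac{(\gamma_1^* )^2(1-\gamma_1^* )(2-\gamma_1^* )^2}{\bigl((\gamma_1^*-1)c_x+c_y\bigr)\bigl(c_x+(\gamma_1^*-1)c_y\bigr)}, & \text{if } c_x>c_y,\end{cases}$$ where $\gamma_1^*\in\bigl(\frac{c_x-c_y}{c_x},1\bigr)$ is the root of the function $\Omega$ defined by the following equation: $$\Omega(\gamma_1):=a_{11}\gamma_1^2(2-\gamma_1)^2-3(1-\gamma_1)^3c_xc_y+2(1-\gamma_1)^2(c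_x^2+c_y^2)+(1-\gamma_1)c_xc_y-c_x^2-c_y^2=0.$$
   Context: Here $\mathbf x=(x_1,x_2)^\top$ and $\mathbf y=(y_1,y_2)^\top$ are real variables, and $a_{11},a_{22},c_x,c_y$ are real coefficients. A real polynomial is PSD (positive semi-definite) if it takes nonnegative values at all real points; it is SOS (sum of squares) if it is a finite sum of squares of real polynomials.
   Formalization: In the second case of (c) the bound is 1/(a_11-c_x^2); the printed extra term -4/(3c_y-sqrt(9c_y^2-4a_11))^2 is dropped, as the printed claim fails, e.g. for c_x=c_y=1, a_11=459/400, a_22=2, where f(1,-4/5;5,-2)<0. *)

(* Defs.v *)
From HB Require Import structures.
From mathcomp Require Export all_boot all_order all_algebra.
From mathcomp Require Export reals.
From mathcomp Require Export mpoly.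

Set Implicit Arguments.
Unset Strict Implicit.
Unset Printing Implicit Defensive.

Import Order.TTheory GRing.Theory Num.Theory.

Local Open Scope ring_scope.

Definition psd (R : realType) (n : nat) (p : {mpoly R[n]}) : Prop :=
  forall v : 'I_n -> R, 0 <= p.@[v].

Definition sos (R : realType) (n : nat) (p : {mpoly R[n]}) : Prop :=
  exists s : seq {mpoly R[n]}, p = \sum_(q <- s) q ^+ 2.

(* The variables x_1, x_2, y_1, y_2 are, in this order, 'X_0, ..., 'X_3. *)
Definition fpoly (R : realType) (a11 a22 cx cy : R) : {mpoly R[4]} :=
  let x1 : {mpoly R[4]} := 'X_(@inord 3 0) in
  let x2 : {mpoly R[4]} := 'X_(@inord 3 1) in
  let y1 : {mpoly R[4]} := 'X_(@inord 3 2) in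
  let y2 : {mpoly R[4]} := 'X_(@inord 3 3) in
  a11 *: (x1 ^+ 2 * y1 ^+ 2) + x1 ^+ 2 * y2 ^+ 2 + x2 ^+ 2 * y1 ^+ 2
  + a22 *: (x2 ^+ 2 * y2 ^+ 2)
  + (2 * cx) *: (x1 ^+ 2 * y1 * y2) + (2 * cy) *: (x1 * x2 * y1 ^+ 2).

Definition Omega (R : realType) (a11 cx cy g : R) : R :=
  a11 * g ^+ 2 * (2 - g) ^+ 2 - 3 * (1 - g) ^+ 3 * cx * cy
  + 2 * (1 - g) ^+ 2 * (cx ^+ 2 + cy ^+ 2) + (1 - g) * cx * cy
  - cx ^+ 2 - cy ^+ 2.

Definition is_gamma (R : realType) (a11 cx cy g : R) : Prop :=
  (cx - cy) / cx < g < 1 /\ Omega a11 cx cy g = 0.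

Definition sdisc (R : realType) (a11 cy : R) : R :=
  3 * cy - Num.sqrt (9 * cy ^+ 2 - 4 * a11).

(* One clause per branch of the lower bound for a22.  In the second branch the
   source prints the bound as 1 / (a11 - cx ^+ 2) - 4 / sdisc a11 cy ^+ 2.  The
   last term is a misprint: with it the first two branches would disagree at
   their common point a11 = 5 / 4 * cy ^+ 2 (4 / cy ^+ 2 against 0), and f
   would not be PSD for, e.g., cx = cy = 1, a11 = 459 / 400, a22 = 2, although
   the printed bound is below 2.  Minimizing f over y reduces PSD-ness to
     a22 >= sup_(t != 0) (cx ^+ 2 / (t ^+ 2 + 2 * cy * t + a11) - 1) / t ^+ 2,
   and in this branch the supremum is 1 / (a11 - cx ^+ 2). *)
Definition a22_bound (R : realType) (a11 a22 cx cy g : R) : Prop :=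
  [/\ cx = cy -> 5 / 4 * cy ^+ 2 <= a11 <= 2 * cy ^+ 2 ->
        a22 >= 8 * cy / sdisc a11 cy ^+ 3 - 4 / sdisc a11 cy ^+ 2,
      cx = cy -> cy ^+ 2 <= a11 <= 5 / 4 * cy ^+ 2 ->
        a22 >= 1 / (a11 - cx ^+ 2)
    & cx > cy ->
        a22 >= g ^+ 2 * (1 - g) * (2 - g) ^+ 2
               / (((g - 1) * cx + cy) * (cx + (g - 1) * cy))].

(* Main.v *)
Require Import Defs.
From mathcomp Require Import ring lra.

Set Implicit Arguments.
Unset Strict Implicit.
Unset Printing Implicit Defensive.

Import Order.TTheory GRing.Theory Num.Theory.
Local Open Scope ring_scope.

(** Every admissible triple (a11, cx, cy) can be written as
      cx = n + q * m,  cy = m + q * n,  a11 = m^2 + n^2 + 3 * q * m * n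
    with m, n > 0 and 0 < q <= 1, and in these parameters each of the three
    statements says a22 * m * n >= q.  Indeed the Gram matrices of f on the
    monomials x1 y1, x1 y2, x2 y1, x2 y2 form a one-parameter family (because
    (x1 y1)(x2 y2) = (x1 y2)(x2 y1)), and the member with entry - q at
    (x1 y1, x2 y2) gives
      f = a22 (x2 y2 - (q / a22) x1 y1)^2 + (x1 y2 + cx x1 y1 + q x2 y1)^2
          + (1 - q^2) (x2 y1 + m x1 y1)^2 + (q m n - q^2 / a22) (x1 y1)^2,
    whereas f = m n (a22 m n - q) at x = (1, - m), y = (1, - n).  If cx > cy
    then q = 1 - gamma; if cx = cy then either m = n or q = 1. *)

(** * Evaluation of the form at real points *)

Definition fval (R : realType) (a11 a22 cx cy x1 x2 y1 y2 : R) : R :=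
  a11 * (x1 ^+ 2 * y1 ^+ 2) + x1 ^+ 2 * y2 ^+ 2 + x2 ^+ 2 * y1 ^+ 2
  + a22 * (x2 ^+ 2 * y2 ^+ 2)
  + (2 * cx) * (x1 ^+ 2 * y1 * y2) + (2 * cy) * (x1 * x2 * y1 ^+ 2).

Lemma meval_fpoly (R : realType) (a11 a22 cx cy : R) (v : 'I_4 -> R) :
  (fpoly a11 a22 cx cy).@[v] =
  fval a11 a22 cx cy (v (inord 0)) (v (inord 1)) (v (inord 2)) (v (inord 3)).
Proof. by rewrite /fpoly !(mevalD, mevalZ, mevalM, rmorphXn, mevalXU). Qed.

Lemma psd_fpolyP (R : realType) (a11 a22 cx cy : R) :
  psd (fpoly a11 a22 cx cy) <->
  forall x1 x2 y1 y2, 0 <= fval a11 a22 cx cy x1 x2 y1 y2.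
Proof.
split=> [f_ge0 x1 x2 y1 y2 | f_ge0 v]; last by rewrite meval_fpoly.
by have := f_ge0 (fun i : 'I_4 => [:: x1; x2; y1; y2]`_i);
  rewrite meval_fpoly !inordK.
Qed.

Lemma sos_psd (R : realType) (n : nat) (p : {mpoly R[n]}) : sos p -> psd p.
Proof.
case=> s -> v; rewrite raddf_sum sumr_ge0 //= => q _.
by rewrite rmorphXn sqr_ge0.
Qed.

Lemma sqr_scale_sqrt (R : realType) (n : nat) (c : R) (p : {mpoly R[n]}) :
  0 <= c -> (Num.sqrt c *: p) ^+ 2 = c *: p ^+ 2.
Proof. by move=> c_ge0; rewrite exprZn sqr_sqrtr. Qed.

(** * The threshold q / (m n) attached to a parameter triple *)

Section Parametrization.

Variables (R : realType) (a11 cx cy : R).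

Definition params (q m n : R) : Prop :=
  [/\ 0 < q <= 1, 0 < m, 0 < n &
      [/\ cx = n + q * m, cy = m + q * n
        & a11 = m ^+ 2 + n ^+ 2 + 3 * q * m * n]].

Lemma params_sos (a22 q m n : R) :
  0 < a22 -> params q m n -> q <= a22 * m * n -> sos (fpoly a11 a22 cx cy).
Proof.
move=> a22_gt0 [/andP[q_gt0 q_le1] m_gt0 n_gt0 [-> -> ->]] q_le.
have k_ge0 : 0 <= 1 - q ^+ 2 by nra.
have rho_ge0 : 0 <= q * m * n - q ^+ 2 / a22.
  have -> : q * m * n - q ^+ 2 / a22 = q / a22 * (a22 * m * n - q).
    by field; rewrite gt_eqF.
  by rewrite mulr_ge0 ?divr_ge0 ?subr_ge0 // ltW.
rewrite /fpoly; set x1 := 'X_(inord 0); set x2 := 'X_(inord 1).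
set y1 := 'X_(inord 2); set y2 := 'X_(inord 3).
exists [:: Num.sqrt a22 *: (x2 * y2 - (q / a22) *: (x1 * y1));
  x1 * y2 + (n + q * m) *: (x1 * y1) + q *: (x2 * y1);
  Num.sqrt (1 - q ^+ 2) *: (x2 * y1 + m *: (x1 * y1));
  Num.sqrt (q * m * n - q ^+ 2 / a22) *: (x1 * y1)].
rewrite !big_cons big_nil !sqr_scale_sqrt ?(ltW a22_gt0) //.
(* Polynomials do not form a field, so the identity is checked by [ring] modulo this relation. *)
have a22K : a22%:MP_[4] * (a22^-1)%:MP_[4] = 1.
  by rewrite -mpolyCM divff ?gt_eqF ?mpolyC1.
rewrite -!mul_mpolyC !(mpolyCD, mpolyCM, mpolyCN, mpolyCB, mpolyC1, rmorphXn).
ring: a22K.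
Qed.

(** Only the first square is kept: at a zero of f it must vanish, which is what [params_inj]
    exploits. *)
Lemma fval_lower_bound (a22 q m n x1 x2 y1 y2 : R) :
  0 < a22 -> params q m n -> q <= a22 * m * n ->
  a22 * (x2 * y2 - q / a22 * (x1 * y1)) ^+ 2 <=
  fval a11 a22 cx cy x1 x2 y1 y2.
Proof.
move=> a22_gt0 [/andP[q_gt0 q_le1] m_gt0 n_gt0 [-> -> ->]] q_le.
have k_ge0 : 0 <= 1 - q ^+ 2 by nra.
rewrite -subr_ge0 [leRHS](_ : _ =
  (x1 * y2 + (n + q * m) * (x1 * y1) + q * (x2 * y1)) ^+ 2
  + (1 - q ^+ 2) * (x2 * y1 + m * (x1 * y1)) ^+ 2
  + q / a22 * (a22 * m * n - q) * (x1 * y1) ^+ 2); last first.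
  by rewrite /fval; field; rewrite gt_eqF.
rewrite !addr_ge0 ?sqr_ge0 // mulr_ge0 ?sqr_ge0 //.
by rewrite mulr_ge0 ?subr_ge0 // divr_ge0 // ltW.
Qed.

Lemma fval_witness (a22 q m n : R) :
  params q m n ->
  fval a11 a22 cx cy 1 (- m) 1 (- n) = m * n * (a22 * m * n - q).
Proof. by case=> _ _ _ [-> -> ->]; rewrite /fval; ring. Qed.

Lemma params_threshold (a22 q m n : R) :
  params q m n -> (q / (m * n) <= a22) = (q <= a22 * m * n).
Proof.
by case=> _ m_gt0 n_gt0 _; rewrite ler_pdivrMr ?mulr_gt0 // mulrA.
Qed.

Lemma psd_threshold (a22 q m n : R) :
  params q m n -> psd (fpoly a11 a22 cx cy) -> q / (m * n) <= a22.
Proof.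
move=> qmn /psd_fpolyP/(_ 1 (- m) 1 (- n)).
rewrite (params_threshold _ qmn) (fval_witness _ qmn).
case: qmn => _ m_gt0 n_gt0 _.
by rewrite pmulr_rge0 ?mulr_gt0 // subr_ge0.
Qed.

Lemma threshold_sos (a22 q m n : R) :
  params q m n -> 0 < a22 -> q / (m * n) <= a22 ->
  sos (fpoly a11 a22 cx cy).
Proof.
by move=> qmn a22_gt0; rewrite (params_threshold _ qmn); apply: params_sos.
Qed.

Lemma threshold_gt0 (q m n : R) : params q m n -> 0 < q / (m * n).
Proof.
by case=> /andP[q_gt0 _] m_gt0 n_gt0 _; rewrite divr_gt0 // mulr_gt0.
Qed.

(** For a22 = q' / (m' n') the second triple makes f SOS, hence PSD, and the witness of the first
    triple bounds this a22 from below. *)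
Lemma threshold_le (q m n q' m' n' : R) :
  params q m n -> params q' m' n' -> q / (m * n) <= q' / (m' * n').
Proof.
move=> qmn qmn'; apply: (psd_threshold qmn); apply: sos_psd.
exact: threshold_sos qmn' (threshold_gt0 qmn') (lexx _).
Qed.

(* Both triples give the same threshold; at this value of a22 the form vanishes
   at (1, - m, 1, - n), hence so does the square in the decomposition coming
   from the other triple. *)
Lemma params_inj (q m n q' m' n' : R) :
  params q m n -> params q' m' n' -> q = q'.
Proof.
move=> qmn qmn'; set a22 := q / (m * n).
have a22_gt0 : 0 < a22 by exact: threshold_gt0 qmn.
have a22E : a22 = q' / (m' * n').
  by apply/le_anti; rewrite !threshold_le.
have mn_neq0 : m * n != 0.
  by case: (qmn) => _ m_gt0 n_gt0 _; rewrite gt_eqF ?mulr_gt0.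
have qE : a22 * m * n = q by rewrite -mulrA divfK.
have /(fval_lower_bound 1 (- m) 1 (- n) a22_gt0 qmn') : q' <= a22 * m' * n'.
  by rewrite -(params_threshold _ qmn') -a22E.
rewrite (fval_witness _ qmn) qE subrr mulr0 mulrNN !mulr1.
rewrite pmulr_rle0 // => sq_le0.
(* Here x1 y1 = 1 and x2 y2 = m n, so the vanishing square gives m n = q' / a22, while q = a22 m
   n. *)
have : (m * n - q' / a22) ^+ 2 == 0 by rewrite eq_le sq_le0 sqr_ge0.
rewrite sqrf_eq0 subr_eq0 => /eqP mnE.
by rewrite -qE -mulrA mnE mulrC divfK ?gt_eqF.
Qed.

End Parametrization.

(** * Parameter triples in the three cases of the bound *)

Section Roots.

Variables (R : realType) (a11 cx cy : R).
Hypotheses (cy_gt0 : 0 < cy) (cx2_lt : cx ^+ 2 < a11).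

(** With q = 1 - g, the equations for cx and cy are linear in m, n with determinant 1 - q^2 = g (2 -
    g). The lower bound on g gives m > 0, and the equation for a11 becomes [Omega] = 0. *)
Lemma gamma_params (g : R) :
  cy < cx -> is_gamma a11 cx cy g ->
  exists m n, params a11 cx cy (1 - g) m n /\
    g ^+ 2 * (1 - g) * (2 - g) ^+ 2
      / (((g - 1) * cx + cy) * (cx + (g - 1) * cy)) = (1 - g) / (m * n).
Proof.
move=> lt_cy_cx [/andP[]]; have cx_gt0 := lt_trans cy_gt0 lt_cy_cx.
rewrite ltr_pdivrMr // => g_gt g_lt1 Omega0.
have g_gt0 : 0 < g by nra.
have k_gt0 : 0 < g * (2 - g) by nra.
have M_gt0 : 0 < (g - 1) * cx + cy by lra.
have N_gt0 : 0 < cx + (g - 1) * cy by nra.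
have g_neq0 : g != 0 by rewrite gt_eqF.
have g2_neq0 : 2 - g != 0 by rewrite gt_eqF // subr_gt0; lra.
exists (((g - 1) * cx + cy) / (g * (2 - g))).
exists ((cx + (g - 1) * cy) / (g * (2 - g))); split; last first.
  by field; rewrite g_neq0 g2_neq0 !gt_eqF.
split; rewrite ?divr_gt0 //; first by apply/andP; split; lra.
split; [by field; rewrite g_neq0 g2_neq0 .. |].
apply/eqP; rewrite -subr_eq0.
rewrite [X in X == _](_ : _ = Omega a11 cx cy g / (g * (2 - g)) ^+ 2).
  by rewrite Omega0 mul0r.
by rewrite /Omega; field; rewrite g_neq0 g2_neq0.
Qed.

Lemma gamma_exists :
  cy < cx -> a11 < cx ^+ 2 + cy ^+ 2 -> exists g, is_gamma a11 cx cy g.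
Proof.
move=> lt_cy_cx a11_lt; have cx_gt0 := lt_trans cy_gt0 lt_cy_cx.
(* The sign is reversed because [poly_ivt] expects a nonpositive value at the left end. *)
pose p : {poly R} := - (a11%:P * 'X ^+ 2 * (2%:P - 'X) ^+ 2
  - 3%:P * (1 - 'X) ^+ 3 * cx%:P * cy%:P
  + 2%:P * (1 - 'X) ^+ 2 * (cx ^+ 2 + cy ^+ 2)%:P + (1 - 'X) * cx%:P * cy%:P
  - (cx ^+ 2)%:P - (cy ^+ 2)%:P).
have pE g : p.[g] = - Omega a11 cx cy g by rewrite /p /Omega !hornerE.
pose g0 := (cx - cy) / cx.
have Omega_g0 : 0 < Omega a11 cx cy g0.
  (* At [g0] one has q = cy / cx, m = 0 and n = cx, so [Omega] is (1 - q^2)^2 (a11 - n^2). *)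
  have -> : Omega a11 cx cy g0 =
      ((cx ^+ 2 - cy ^+ 2) / cx ^+ 2) ^+ 2 * (a11 - cx ^+ 2).
    by rewrite /Omega /g0; field; rewrite gt_eqF.
  rewrite mulr_gt0 ?subr_gt0 // exprn_gt0 // divr_gt0 ?exprn_gt0 //.
  by rewrite subr_gt0 ltr_pXn2r // nnegrE ltW.
have Omega_1 : Omega a11 cx cy 1 < 0.
  have -> : Omega a11 cx cy 1 = a11 - (cx ^+ 2 + cy ^+ 2).
    by rewrite /Omega; ring.
  by rewrite subr_lt0.
have g0_le1 : g0 <= 1 by rewrite ler_pdivrMr // mul1r lerBlDr lerDl ltW.
have [|g /andP[g0_le g_le1]] := poly_ivt (p := p) g0_le1.
  by rewrite !pE oppr_le0 oppr_ge0 !ltW.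
rewrite /root pE oppr_eq0 => /eqP Omega_g; exists g; split=> //.
rewrite !lt_neqAle g0_le g_le1 !andbT; apply/andP; split; apply/eqP => gE.
  by move: Omega_g0; rewrite /g0 gE Omega_g ltxx.
by move: Omega_1; rewrite -gE Omega_g ltxx.
Qed.

(** No study of the quartic [Omega] is required: each root yields a triple with q = 1 - g, and q is
    unique. *)
Lemma gamma_unique (g g' : R) :
  cy < cx -> is_gamma a11 cx cy g -> is_gamma a11 cx cy g' -> g = g'.
Proof.
move=> lt_cy_cx /(gamma_params lt_cy_cx)[m [n [qmn _]]].
move=> /(gamma_params lt_cy_cx)[m' [n' [qmn' _]]].
by have := params_inj qmn qmn'; lra.
Qed.

(** This is the case m = n. Eliminating q from cy = m (1 + q) and a11 = m^2 (2 + 3 q) gives m^2 - 3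
    cy m + a11 = 0, whose smaller root is m = s / 2; then 0 < q <= 1 amounts to cy <= s < 2 cy. *)
Lemma sdisc_params :
  cx = cy -> 5 / 4 * cy ^+ 2 <= a11 < 2 * cy ^+ 2 ->
  exists q m n, params a11 cx cy q m n /\
    8 * cy / sdisc a11 cy ^+ 3 - 4 / sdisc a11 cy ^+ 2 = q / (m * n).
Proof.
move=> cxE /andP[a11_ge a11_lt]; rewrite cxE /sdisc.
have disc_ge0 : 0 <= 9 * cy ^+ 2 - 4 * a11 by nra.
have := sqrtr_ge0 (9 * cy ^+ 2 - 4 * a11); have := sqr_sqrtr disc_ge0.
set r := Num.sqrt _; clearbody r => r2E r_ge0; set s := 3 * cy - r.
have r_le : r <= 2 * cy.
  rewrite -(ler_pXn2r (ltn0Sn 1)) ?nnegrE ?mulr_ge0 //; last exact: ltW.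
  by rewrite exprMn r2E; lra.
have r_gt : cy < r.
  rewrite -(ltr_pXn2r (ltn0Sn 1)) ?nnegrE //; last exact: ltW.
  by rewrite r2E; lra.
have s_ge : cy <= s by rewrite /s; lra.
have s_lt : s < 2 * cy by rewrite /s; lra.
have s_gt0 : 0 < s by lra.
have a11E : a11 = (6 * cy * s - s ^+ 2) / 4.
  have -> : a11 = (9 * cy ^+ 2 - r ^+ 2) / 4 by rewrite r2E; field.
  by rewrite /s; field.
exists (2 * cy / s - 1), (s / 2), (s / 2); split; last first.
  by field; rewrite gt_eqF.
split; rewrite ?divr_gt0 //.
  apply/andP; split; first by rewrite subr_gt0 ltr_pdivlMr // mul1r.
  by rewrite lerBlDr ler_pdivrMr //; lra.
by rewrite a11E; split; field; rewrite gt_eqF.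
Qed.

(** This is the case q = 1: m + n = cy and m n = a11 - cy^2, so m and n are the roots of a quadratic
    with discriminant 5 cy^2 - 4 a11. *)
Lemma params_at_one :
  cx = cy -> a11 <= 5 / 4 * cy ^+ 2 ->
  exists q m n, params a11 cx cy q m n /\ 1 / (a11 - cx ^+ 2) = q / (m * n).
Proof.
move=> cxE a11_le.
have disc_ge0 : 0 <= 5 * cy ^+ 2 - 4 * a11 by lra.
have := sqrtr_ge0 (5 * cy ^+ 2 - 4 * a11); have := sqr_sqrtr disc_ge0.
set r := Num.sqrt _; clearbody r => r2E r_ge0.
have a11E : a11 = (5 * cy ^+ 2 - r ^+ 2) / 4 by rewrite r2E; field.
have r_lt : r < cy.
  rewrite -(ltr_pXn2r (ltn0Sn 1)) ?nnegrE //; last exact: ltW.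
  by rewrite r2E; move: cx2_lt; rewrite cxE; lra.
exists 1, ((cy + r) / 2), ((cy - r) / 2); split.
  split; rewrite ?ltr01 ?lexx ?divr_gt0 ?subr_gt0 ?ltr_pwDl //.
  by rewrite cxE {1}a11E; split; field.
by congr (_ / _); rewrite cxE a11E; field.
Qed.

End Roots.

Theorem theorem4p8 (R : realType) (a11 a22 cx cy : R)
    (ha11 : cx ^+ 2 < a11 < cx ^+ 2 + cy ^+ 2) (ha22 : 0 < a22)
    (hc : cx >= cy) (hcy : cy > 0) :
  (cx > cy -> exists! g : R, is_gamma a11 cx cy g) /\
  (forall g : R, (cx > cy -> is_gamma a11 cx cy g) ->
     [<-> psd (fpoly a11 a22 cx cy);
          sos (fpoly a11 a22 cx cy);
          a22_bound a11 a22 cx cy g]).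
Proof.
have /andP[a11_gt a11_lt] := ha11.
split=> [lt_cy_cx | g gP].
  have [g gP] := gamma_exists hcy a11_gt lt_cy_cx a11_lt.
  by exists g; split=> // g'; exact: (gamma_unique hcy lt_cy_cx gP).
have bound_sos : a22_bound a11 a22 cx cy g -> sos (fpoly a11 a22 cx cy).
  case=> b1 b2 b3; move: hc; rewrite le_eqVlt => /predU1P[cyE | lt_cy_cx].
    have cxE := esym cyE.
    have [a11_ge | /ltW a11_le] := leP (5 / 4 * cy ^+ 2) a11.
      have hyp : 5 / 4 * cy ^+ 2 <= a11 < 2 * cy ^+ 2.
        by rewrite a11_ge mulr_natl mulr2n -{1}cxE.
      have [q [m [n [qmn qE]]]] := sdisc_params hcy cxE hyp.
      apply: (threshold_sos qmn ha22); rewrite -qE; apply: b1 => //.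
      by case/andP: hyp => -> /ltW.
    have [q [m [n [qmn qE]]]] := params_at_one hcy a11_gt cxE a11_le.
    apply: (threshold_sos qmn ha22); rewrite -qE; apply: b2 => //.
    by rewrite a11_le -cxE ltW.
  have [m [n [qmn qE]]] := gamma_params hcy lt_cy_cx (gP lt_cy_cx).
  by apply: (threshold_sos qmn ha22); rewrite -qE; apply: b3.
have psd_bound : psd (fpoly a11 a22 cx cy) -> a22_bound a11 a22 cx cy g.
  move=> f_psd; split=> [cxE /andP[a11_ge _] | cxE /andP[_ a11_le] | lt_cy_cx].
  (* For cx = cy the hypothesis a11 < cx^2 + cy^2 makes the upper bound strict, which ensures q >
     0. *)
  - have hyp : 5 / 4 * cy ^+ 2 <= a11 < 2 * cy ^+ 2.
      by rewrite a11_ge mulr_natl mulr2n -{1}cxE.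
    have [q [m [n [qmn ->]]]] := sdisc_params hcy cxE hyp.
    exact: psd_threshold qmn f_psd.
  - have [q [m [n [qmn ->]]]] := params_at_one hcy a11_gt cxE a11_le.
    exact: psd_threshold qmn f_psd.
  - have [m [n [qmn ->]]] := gamma_params hcy lt_cy_cx (gP lt_cy_cx).
    exact: psd_threshold qmn f_psd.
tfae=> [/psd_bound/bound_sos // | /sos_psd/psd_bound // |].
by move/bound_sos/sos_psd.
Qed.
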